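(* Let $\mathcal{I}=\langle\mathbf{C},\mathbb{X},O,tr\rangle$ be a context interactive system with $\|\mathbf{C}\|$ countable and $tr$ of countable degree. For $i\in|\mathbf{C}|$ and $p\in X_i$ put $\alpha_{\mathcal{I}}(p)=\{(c,o,q)\mid c\in\mathbf{C}[i,j]\text{ for some }j,\ (c_{\mathbb{X}}(p),o,q)\in tr\}$. Then $\langle\mathbb{X},\alpha_{\mathcal{I}}\rangle$ is an $\mathbf{H}$-coalgebra, i.e. $\alpha_{\mathcal{I}}:\mathbb{X}\to\mathbf{H}(\mathbb{X})$ is a $\Gamma(\mathbf{C})$-homomorphism.
   Context: Composition is in diagrammatic order: $d;e$ means first $d$, then $e$. $|\mathbf{C}|$ and $\|\mathbf{C}\|$ are the sets of objects and arrows of a small category $\mathbf{C}$. A $\Gamma(\mathbf{C})$-algebra $\mathbb{X}$ is a family of sets $X=(X_i)_{i\in|\mathbf{C}|}$ with a function $c_{\mathbb{X}}:X_i\to X_j$ for every $c\in\mathbf{C}[i,j]$ such that $(id_i)_{\mathbb{X}}=id_{X_i}$ and $(d;e)_{\mathbb{X}}(x)=e_{\mathbb{X}}(d_{\mathbb{X}}(x))$ (i.e. a functor $\mathbf{C}\to\mathbf{Set}$); homomorphisms are natural transformations; the category is $\mathbf{Alg}_{\Gamma(\mathbf{C})}$. $\int X=\sum_iX_i$ is the disjoint union. A context interactive system is a quadruple $\langle\mathbf{C},\mathbb{X},O,tr\rangle$ with $\mathbf{C}$ a small category, $\mathbb{X}$ a $\Gamma(\mathbf{C})$-algebra, $O$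 a set (observations) and $tr\subseteq\int X\times O\times\int X$. Countable degree means that each state has at most countably many outgoing transitions. $\mathbf{G}(X)_i$ is the set of (at most) countable subsets of $\sum_{j\in|\mathbf{C}|}\mathbf{C}[i,j]\times O\times\int X$. The endofunctor $\mathbf{H}$ of $\mathbf{Alg}_{\Gamma(\mathbf{C})}$ maps $\mathbb{X}$ to the algebra with carrier $(\mathbf{G}(X)_i)_i$ and operations, for $d\in\mathbf{C}[i,k]$ and $A\in\mathbf{G}(X)_i$, $d_{\mathbf{H}(\mathbb{X})}(A)=\{(c_2,o,x)\mid (c_1,o,x)\in A,\ c_1=d;c_2\}$; on arrows $\mathbf{H}(h)(A)=\{(c,o,h(x))\mid(c,o,x)\in A\}$. An $\mathbf{H}$-coalgebra is a pair $\langle\mathbb{X},\alpha\rangle$ with $\alpha:\mathbb{X}\to\mathbf{H}(\mathbb{X})$ a homomorphism. *)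

(* Defs.v *)
From mathcomp Require Import all_boot.
From mathcomp Require Import all_classical.

Set Implicit Arguments.
Unset Strict Implicit.
Unset Printing Implicit Defensive.

Local Open Scope classical_set_scope.

(* Composition is diagrammatic: [seqm d e] is d ; e, first d and then e. *)
Record category := Category {
  obj :> Type;
  hom : obj -> obj -> Type;
  idm : forall i, hom i i;
  seqm : forall i j k, hom i j -> hom j k -> hom i k;
  seqm_idl : forall i j (d : hom i j), seqm (idm i) d = d;
  seqm_idr : forall i j (d : hom i j), seqm d (idm j) = d;
  seqm_assoc : forall i j k l (c : hom i j) (d : hom j k) (e : hom k l),
    seqm (seqm c d) e = seqm c (seqm d e) }.

Definition arrows_from (C : category) (i : C) := {j : C & hom i j}.
Definition arrows (C : category) := {i : C & arrows_from i}.

Definition precomp (C : category) (i k : C) (d : hom i k)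
    (c : arrows_from k) : arrows_from i :=
  existT _ (projT1 c) (seqm d (projT2 c)).

Record algebra (C : category) := Algebra {
  carrier :> C -> Type;
  op : forall i j, hom i j -> carrier i -> carrier j;
  op_id : forall i (x : carrier i), op (idm i) x = x;
  op_comp : forall i j k (d : hom i j) (e : hom j k) (x : carrier i),
    op (seqm d e) x = op e (op d x) }.

Definition state (C : category) (X : algebra C) := {i : C & X i}.

Definition inj_state (C : category) (X : algebra C) (i : C) (x : X i) :
  state X := existT _ i x.

Definition is_alg_hom (C : category) (X Y : algebra C)
    (f : forall i, X i -> Y i) : Prop :=
  forall (i j : C) (d : hom i j) (x : X i), f j (op d x) = op d (f i x).

Record alg_hom (C : category) (X Y : algebra C) := AlgHom {
  alg_map :> forall i, X i -> Y i;
  alg_homP : is_alg_hom alg_map }.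

Definition state_map (C : category) (X Y : algebra C) (h : alg_hom X Y)
    (x : state X) : state Y := inj_state (h _ (projT2 x)).

Lemma alg_id_subproof (C : category) (X : algebra C) :
  @is_alg_hom C X X (fun _ x => x).
Proof. by []. Qed.
Definition alg_id (C : category) (X : algebra C) : alg_hom X X :=
  AlgHom (@alg_id_subproof C X).

Lemma alg_comp_subproof (C : category) (X Y Z : algebra C)
    (f : alg_hom X Y) (g : alg_hom Y Z) :
  @is_alg_hom C X Z (fun i x => g i (f i x)).
Proof. by move=> i j d x; rewrite !alg_homP. Qed.
Definition alg_comp (C : category) (X Y Z : algebra C)
    (f : alg_hom X Y) (g : alg_hom Y Z) : alg_hom X Z :=
  AlgHom (@alg_comp_subproof C X Y Z f g).

Lemma alg_hom_ext (C : category) (X Y : algebra C) (f g : alg_hom X Y) :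
  (forall i x, f i x = g i x) -> f = g.
Proof.
case: f g => [f fP] [g gP] /= fg.
have e : f = g by apply: functional_extensionality_dep => i; apply/funext.
by move: fP gP; rewrite e => fP gP; congr AlgHom; exact: Prop_irrelevance.
Qed.

Record endofunctor (C : category) := Endofunctor {
  fobj :> algebra C -> algebra C;
  fmap : forall X Y : algebra C, alg_hom X Y -> alg_hom (fobj X) (fobj Y);
  fmap_id : forall X, fmap (alg_id X) = alg_id (fobj X);
  fmap_comp : forall X Y Z (f : alg_hom X Y) (g : alg_hom Y Z),
    fmap (alg_comp f g) = alg_comp (fmap f) (fmap g) }.

(* <X, alpha> is an F-coalgebra, for alpha given as a bare family of maps. *)
Definition is_coalgebra (C : category) (F : endofunctor C) (X : algebra C)
    (alpha : forall i, X i -> F X i) : Prop :=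
  is_alg_hom alpha.

(* A transition of a coalgebra out of a state of sort i: a triple (c, o, x)
   where c is an arrow out of i, o an observation and x a target state. *)
Definition transition (C : category) (O : Type) (X : algebra C) (i : C) :
    Type :=
  (arrows_from i * O * state X)%type.

Definition Gset (C : category) (O : Type) (X : algebra C) (i : C) : Type :=
  {A : set (transition O X i) | countable A}.

Lemma Gset_ext (C : category) (O : Type) (X : algebra C) (i : C)
    (A B : Gset O X i) : sval A = sval B -> A = B.
Proof.
case: A B => [A cA] [B cB] /= AB.
by move: cA cB; rewrite AB => cA cB; congr exist; exact: Prop_irrelevance.
Qed.

Definition Hop_set (C : category) (O : Type) (X : algebra C) (i k : C)
    (d : hom i k) (A : set (transition O X i)) : set (transition O X k) :=
  [set m | exists c1, A (c1, m.1.2, m.2) /\ c1 = precomp d m.1.1].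

Definition Hmap_set (C : category) (O : Type) (X Y : algebra C)
    (h : alg_hom X Y) (i : C) (A : set (transition O X i)) :
  set (transition O Y i) :=
  [set (m.1.1, m.1.2, state_map h m.2) | m in A].

Definition countable_arrows (C : category) : Prop := countable [set: arrows C].

Lemma countable_arrows_from (C : category) (i : C) :
  countable_arrows C -> countable [set: arrows_from i].
Proof.
move=> /countable_injP[f fi]; apply/countable_injP.
exists (fun c => f (existT _ i c)) => c c' _ _ /fi.
rewrite !inE => /(_ I I) e.
have := projT2_eq e; rewrite (Prop_irrelevance (projT1_eq e) erefl).
by [].
Qed.

(* Needs the countability of C: one arrow c1 can factor as d ; c2 for many
   different c2. *)
Lemma Hop_countable (C : category) (hC : countable_arrows C) (O : Type)
    (X : algebra C) (i k : C) (d : hom i k) (A : set (transition O X i)) :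
  countable A -> countable (Hop_set d A).
Proof.
move=> cA.
pose B := (fun m : transition O X i => (m.1.2, m.2)) @` A.
have cB : countable B by apply: sub_countable cA; exact: card_image_le.
have := countableX (countable_arrows_from k hC) cB.
move=> /(sub_countable (card_image_le (fun y => (y.1, y.2.1, y.2.2)) _)).
apply: sub_countable; apply: subset_card_le => -[[c o] x] [c1 [Ac1 _]] /=.
by exists (c, (o, x)) => //; split => //=; exists (c1, o, x).
Qed.

Definition Hop (C : category) (hC : countable_arrows C) (O : Type)
    (X : algebra C) (i k : C) (d : hom i k) (A : Gset O X i) : Gset O X k :=
  exist _ (Hop_set d (sval A)) (Hop_countable hC d (svalP A)).

Lemma Hop_id_subproof (C : category) (hC : countable_arrows C) (O : Type)
    (X : algebra C) (i : C) (A : Gset O X i) : Hop hC (idm i) A = A.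
Proof.
have pid (c : arrows_from i) : precomp (idm i) c = c.
  by case: c => j c; rewrite /precomp /= seqm_idl.
apply: Gset_ext; apply/seteqP; split => -[[c o] x] /=.
  by move=> [c1 [Ac1 c1E]]; rewrite -[c]pid -c1E.
by exists c; rewrite pid.
Qed.

Lemma Hop_comp_subproof (C : category) (hC : countable_arrows C) (O : Type)
    (X : algebra C) (i j k : C) (d : hom i j) (e : hom j k) (A : Gset O X i) :
  Hop hC (seqm d e) A = Hop hC e (Hop hC d A).
Proof.
have pcomp (c : arrows_from k) :
    precomp (seqm d e) c = precomp d (precomp e c).
  by case: c => l c; rewrite /precomp /= seqm_assoc.
apply: Gset_ext; apply/seteqP; split => -[[c o] x] /=.
  move=> [c1 [Ac1 c1E]]; exists (precomp e c); split => //.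
  by exists c1; rewrite -pcomp.
move=> [c2 [[c1 [Ac1 c1E]] c2E]]; exists c1; split => //.
by rewrite pcomp -c2E.
Qed.

Definition Hobj (C : category) (hC : countable_arrows C) (O : Type)
    (X : algebra C) : algebra C :=
  @Algebra C (Gset O X) (@Hop C hC O X)
    (@Hop_id_subproof C hC O X) (@Hop_comp_subproof C hC O X).

Lemma Hmap_countable (C : category) (O : Type) (X Y : algebra C)
    (h : alg_hom X Y) (i : C) (A : set (transition O X i)) :
  countable A -> countable (Hmap_set h A).
Proof. by apply: sub_countable; exact: card_image_le. Qed.

Lemma Hmap_subproof (C : category) (hC : countable_arrows C) (O : Type)
    (X Y : algebra C) (h : alg_hom X Y) :
  @is_alg_hom C (Hobj hC O X) (Hobj hC O Y)
    (fun i A => exist _ (Hmap_set h (sval A)) (Hmap_countable h (svalP A))).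
Proof.
move=> i j d A; apply: Gset_ext; apply/seteqP; split => -[[c o] y] /=.
  move=> [[[c' o'] x] /= [c1 [Ac1 c1E]]] [<- <- <-].
  by exists c1; split => //; exists (c1, o', x).
move=> [c1 [[[[c' o'] x] /= Ac' [c'E <- <-]] c1E]].
by exists (c, o', x) => //=; exists c'; split => //; rewrite c'E.
Qed.

Definition Hmap (C : category) (hC : countable_arrows C) (O : Type)
    (X Y : algebra C) (h : alg_hom X Y) :
    alg_hom (Hobj hC O X) (Hobj hC O Y) :=
  AlgHom (@Hmap_subproof C hC O X Y h).

Lemma Hmap_id_subproof (C : category) (hC : countable_arrows C) (O : Type)
    (X : algebra C) : Hmap hC O (alg_id X) = alg_id (Hobj hC O X).
Proof.
have tid (y : state X) : state_map (alg_id X) y = y by case: y.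
apply: alg_hom_ext => i A; apply: Gset_ext; apply/seteqP.
split => -[[c o] x] /=.
  by move=> [[[c' o'] x'] /= Ac' [<- <- <-]]; rewrite tid.
by exists (c, o, x); rewrite //= tid.
Qed.

Lemma Hmap_comp_subproof (C : category) (hC : countable_arrows C) (O : Type)
    (X Y Z : algebra C) (f : alg_hom X Y) (g : alg_hom Y Z) :
  Hmap hC O (alg_comp f g) = alg_comp (Hmap hC O f) (Hmap hC O g).
Proof.
apply: alg_hom_ext => i A; apply: Gset_ext; apply/seteqP; split => m /=.
  move=> [m' Am' <-]; exists (m'.1.1, m'.1.2, state_map f m'.2) => //.
  by exists m'.
by move=> [_ [m' Am' <-] <-]; exists m'.
Qed.

Definition functorH (C : category) (hC : countable_arrows C) (O : Type) :
    endofunctor C :=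
  @Endofunctor C (Hobj hC O) (@Hmap C hC O)
    (@Hmap_id_subproof C hC O) (@Hmap_comp_subproof C hC O).

Record context_interactive_system := ContextInteractiveSystem {
  cis_cat : category;
  cis_alg : algebra cis_cat;
  cis_obs : Type;
  cis_tr : set (state cis_alg * cis_obs * state cis_alg) }.

Definition countable_degree (I : context_interactive_system) : Prop :=
  forall p : state (cis_alg I),
    countable [set m : cis_obs I * state (cis_alg I) |
               cis_tr (p, m.1, m.2)].

Definition alpha_set (I : context_interactive_system) (i : cis_cat I)
    (p : cis_alg I i) : set (transition (cis_obs I) (cis_alg I) i) :=
  [set m | cis_tr (inj_state (op (projT2 m.1.1) p), m.1.2, m.2)].

(* Main.v *)
Require Import Defs.
From mathcomp Require Import all_boot.
From mathcomp Require Import all_classical.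

Local Open Scope classical_set_scope.

(** The homomorphism law is functoriality of the algebra: (c, o, q) lies in alpha(d(p)) iff
    (c(d(p)), o, q) is in [cis_tr], and in d(alpha(p)) iff ((d;c)(p), o, q) is; [op_comp] equates
    the two sources. [alpha_set_countable] places alpha(p) in [Gset]. *)

(* A transition of p is an arrow c together with a transition of c(p), so
   alpha(p) is a countable union of countable sets. *)
Lemma alpha_set_countable (I : context_interactive_system)
    (hC : countable_arrows (cis_cat I)) (htr : countable_degree I)
    (i : cis_cat I) (p : cis_alg I i) : countable (alpha_set p).
Proof.
pose F (c : arrows_from i) :=
  (fun m : cis_obs I * state (cis_alg I) => (c, m.1, m.2)) @`
  [set m | cis_tr (inj_state (op (projT2 c) p), m.1, m.2)].
have FE : alpha_set p `<=` \bigcup_c F c.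
  by move=> [[c o] x] tr_cox; exists c => //; exists (o, x).
apply: (sub_countable (subset_card_le FE)).
apply: bigcup_countable => [|c _]; first exact: countable_arrows_from.
by apply: sub_countable (htr _); exact: card_image_le.
Qed.

Theorem theorem6p3 (I : context_interactive_system)
    (hC : countable_arrows (cis_cat I)) (htr : countable_degree I) :
  exists alpha : forall i : cis_cat I,
      cis_alg I i -> functorH hC (cis_obs I) (cis_alg I) i,
    (forall (i : cis_cat I) (p : cis_alg I i),
       sval (alpha i p) = alpha_set p) /\
    is_coalgebra alpha.
Proof.
exists (fun i p => exist _ (alpha_set p) (alpha_set_countable I hC htr i p)).
split=> // i k d p; apply: Gset_ext; apply/seteqP; split=> -[[c o] x] /=.
  (* The operation of [Hobj] along d forces c1 = d;c. *)
  by move=> tr_cox; exists (precomp d c); rewrite /alpha_set /= op_comp.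
by move=> [c1 [+ c1E]]; rewrite c1E /alpha_set /= op_comp.
Qed.
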